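(* Let $\mathfrak g=\mathfrak{su}(2)$ and let $\pi_{\mathcal F}$ be the Poisson structure on $M_o$ described in the context. Then the functions $$\langle a,b\rangle,\quad \langle b,c\rangle,\quad \langle c,a\rangle,\quad \langle a,a\rangle-\langle b,b\rangle,\quad \langle b,b\rangle-\langle c,c\rangle$$ form a complete set of Casimirs for $\pi_{\mathcal F}$ on $M_o$.
   Context: $\mathfrak g=\mathfrak{su}(2)$ carries an Ad-invariant positive-definite inner product $\langle\cdot,\cdot\rangle$ (a multiple of the Killing form), used to identify $\mathfrak g^*$ with $\mathfrak g$. $M=L(\mathfrak g,\mathfrak{su}(2))$ is the space of linear maps, where the target is regarded as an oriented Euclidean space. A frame is an orthonormal basis $\mathcal F=\{e_1,e_2,e_3\}$ of the target (of a fixed orientation); it identifies $M$ with $\mathfrak g\times\mathfrak g\times\mathfrak g$ via $\Psi_{\mathcal F}:\phi\mapsto(a,b,c)$, $\phi(x)=\langle a,x\rangle e_1+\langle b,x\rangle e_2+\langle c,x\rangle e_3$. $\Phi(a,b,c)=\langle a,[b,c]\rangle$, $M_o=\{\Phi\neq0\}$, and on $M_o$ $$A(a,b,c)=\frac1{\Phi}\big([a,b]\otimes[a,b]+[b,c]\otimes[b,c]+[c,a]\otimes[c,a]\big)\in S^2(\mathfrak g),$$ with $A_{\xi,\eta}$ its contraction with $\xi,\eta\in\mathfrak g$. With $l^1_\xi(a,b,c)=\langle\xi,a\rangle$, $l^2_\xi(a,b,c)=\langle\xi,b\rangle$, $l^3_\xi(a,b,c)=\langle\xi,c\rangle$, $\pi_{\mathcal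 F}$ is the Poisson structure on $M_o$ whose bracket, under $\Psi_{\mathcal F}$, is $$\{l^1_\xi,l^1_\eta\}=l^1_{[\xi,\eta]},\quad \{l^1_\xi,l^2_\eta\}=\{l^2_\xi,l^1_\eta\}=l^2_{[\xi,\eta]},\quad \{l^2_\xi,l^2_\eta\}=-l^1_{[\xi,\eta]},$$ $$\{l^1_\xi,l^3_\eta\}=\{l^3_\xi,l^1_\eta\}=l^3_{[\xi,\eta]},\quad \{l^3_\xi,l^3_\eta\}=-l^1_{[\xi,\eta]},\quad \{l^2_\xi,l^3_\eta\}=-\{l^3_\xi,l^2_\eta\}=A_{\xi,\eta}.$$ A Casimir is a function $f$ with $\{f,\cdot\}=0$. A set of Casimirs is complete if the functions are independent (linearly independent differentials) and their number equals the codimension of the symplectic leaves (so that at each point the common kernel of their differentials is the tangent space of the symplectic leaf). *)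

(* Defs.v *)
From HB Require Import structures.
From mathcomp Require Import all_boot all_order all_algebra.
From mathcomp Require Import complex.
From mathcomp Require Import all_classical all_reals all_analysis.

Set Implicit Arguments.
Unset Strict Implicit.
Unset Printing Implicit Defensive.

Import Order.TTheory GRing.Theory Num.Theory.
Import numFieldNormedType.Exports.

Local Open Scope classical_set_scope.
Local Open Scope complex_scope.
Local Open Scope ring_scope.

(* su(2): traceless skew-Hermitian 2 x 2 complex matrices, a real Lie algebra
   of dimension 3.  An element is stored as the row of its coordinates in the
   basis (i sigma_1, i sigma_2, i sigma_3), with sigma_k the Pauli matrices;
   [su2_mx] is the matrix itself and the bracket is the matrix commutator. *)
Notation su2 R := 'rV[R]_3 (only parsing).

Section Su2.
Variable R : realType.
Implicit Types x y z : su2 R.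

Definition su2_mx x : 'M[R[i]]_2 :=
  \matrix_(i, j)
    if i == 0 then (if j == 0 then 0 +i* x 0 2 else x 0 1 +i* x 0 0)
    else (if j == 0 then (- x 0 1) +i* x 0 0 else 0 +i* (- x 0 2)).

Definition su2_coord (X : 'M[R[i]]_2) : su2 R :=
  \row_k [:: complex.Im (X 0 1); complex.Re (X 0 1); complex.Im (X 0 0)]`_k.

Definition in_su2 (X : 'M[R[i]]_2) : Prop :=
  (map_mx (@conjc R) X)^T = - X /\ \tr X = 0.

Definition lie x y : su2 R :=
  su2_coord (su2_mx x *m su2_mx y - su2_mx y *m su2_mx x).

Lemma su2_mxK : cancel su2_mx su2_coord.
Proof.
move=> x; apply/rowP => k; rewrite !mxE /=.
by case: k => [[|[|[|//]]] lt_k] /=; congr (x _ _); apply/val_inj.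
Qed.

Lemma ord2P (P : 'I_2 -> Prop) : P 0 -> P 1 -> forall i, P i.
Proof.
move=> P0 P1 i; have [-> // | ->] // : i = 0 \/ i = 1.
by case: i => [[|[|//]] lt_i]; [left | right]; apply/val_inj.
Qed.

Lemma mxtrace2 (X : 'M[R[i]]_2) : \tr X = X 0 0 + X 1 1.
Proof.
rewrite /mxtrace !big_ord_recl big_ord0 addr0.
by congr (_ + X _ _); apply/val_inj.
Qed.

Lemma su2_mx_in x : in_su2 (su2_mx x).
Proof.
split; last by rewrite mxtrace2 !mxE /=; simpc.
apply/matrixP; elim/ord2P; elim/ord2P; rewrite !mxE /=; simpc;
  by rewrite ?oppr0 ?opprK.
Qed.

Lemma su2_coordK X : in_su2 X -> su2_mx (su2_coord X) = X.
Proof.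
move=> [/matrixP sk tr0]; apply/matrixP.
have eq0 (a : R) : a = - a -> a = 0.
  by move=> e; apply/eqP; rewrite -[_ == 0](mulrn_eq0 a 2) mulr2n {1}e addNr.
move: tr0 (sk 0 0) (sk 0 1) (sk 1 1); rewrite mxtrace2 !mxE.
case E00: (X 0 0) => [a b]; case E01: (X 0 1) => [c d].
case E10: (X 1 0) => [c' d']; case E11: (X 1 1) => [a' b'].
simpc => -[_ eb] [/eq0-a0] [ec ed] [/eq0-a'0].
elim/ord2P; elim/ord2P; rewrite !mxE /= ?E00 ?E01 ?E10 ?E11 /= ?a0 ?a'0 //.
    by rewrite ec -[d]opprK -ed opprK.
by congr (_ +i* _); apply/esym/eqP; rewrite -addr_eq0 addrC eb.
Qed.

Lemma in_su2_commutator X Y :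
  in_su2 X -> in_su2 Y -> in_su2 (X *m Y - Y *m X).
Proof.
move=> [sX _] [sY _]; split; last by rewrite raddfB /= mxtrace_mulC subrr.
rewrite map_mxB !map_mxM raddfB /= !trmx_mul sX sY.
by rewrite !mulmxN !mulNmx !opprK opprB.
Qed.

Lemma su2_mx_lie x y :
  su2_mx (lie x y) = su2_mx x *m su2_mx y - su2_mx y *m su2_mx x.
Proof. by apply/su2_coordK/in_su2_commutator; apply: su2_mx_in. Qed.

Definition killing x y : R := \tr (lin1_mx (lie x) *m lin1_mx (lie y)).

End Su2.

(* The space of linear maps from su(2) to su(2): the matrix [phi] stands for
   x |-> x *m phi in the coordinates above. *)
Notation lin_su2 R := 'M[R]_3 (only parsing).

Section Frames.
Variable R : realType.

Definition inner_product (ip : su2 R -> su2 R -> R) : Prop :=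
  [/\ forall x y, ip x y = ip y x,
      forall (k : R) (x y z : su2 R), ip (k *: x + y) z = k * ip x z + ip y z
    & forall x : su2 R, x != 0 -> 0 < ip x x].

(* The orientation of the target is the sign [s], relative to the basis
   of the coordinates. *)
Definition frame (ipV : su2 R -> su2 R -> R) (s : bool)
    (e : 'I_3 -> su2 R) : Prop :=
  (forall i j, ipV (e i) (e j) = (i == j)%:R) /\
  0 < (-1) ^+ s * \det (\matrix_i e i).

(* [Psi phi] is the triple (a, b, c), indexed by 0, 1, 2. *)
Definition frame_coordinates (ip : su2 R -> su2 R -> R)
    (e : 'I_3 -> su2 R) (Psi : lin_su2 R -> 'I_3 -> su2 R) : Prop :=
  forall (phi : lin_su2 R) (x : su2 R),
    x *m phi = \sum_(i < 3) ip (Psi phi i) x *: e i.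

End Frames.

Section Poisson.
Variable R : realType.
Implicit Types (f g h : lin_su2 R -> R) (U : set (lin_su2 R)) (p : lin_su2 R).
(* A bivector field, by its components in the canonical coordinates of 'M_3,
   which are numbered by mxvec. *)
Implicit Type pi : lin_su2 R -> 'M[R]_(3 * 3).

Fixpoint iter_derive (vs : seq (lin_su2 R)) f : lin_su2 R -> R :=
  if vs is v :: vs' then fun p => 'D_v (iter_derive vs' f) p else f.

(* C^oo on the open set U; values outside U are irrelevant. *)
Definition smooth_on U f : Prop :=
  forall vs p, U p -> differentiable (iter_derive vs f) p.

Definition differential f p : 'rV[R]_(3 * 3) :=
  mxvec (\matrix_(i, j) 'D_(delta_mx i j) f p).

Definition bracket pi f g p : R :=
  (differential f p *m pi p *m (differential g p)^T) 0 0.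

Definition poisson_structure U pi : Prop :=
  [/\ forall p, U p -> (pi p)^T = - pi p,
      forall i j, smooth_on U (fun p => pi p i j)
    & forall f g h, smooth_on U f -> smooth_on U g -> smooth_on U h ->
        forall p, U p ->
          bracket pi f (bracket pi g h) p + bracket pi g (bracket pi h f) p
            + bracket pi h (bracket pi f g) p = 0].

Definition casimir U pi f : Prop :=
  smooth_on U f /\
  forall h, smooth_on U h -> forall p, U p -> bracket pi f h p = 0.

(* The symplectic leaves are the integral manifolds of the characteristic
   distribution of pi: the tangent space at p of the leaf through p is the image
   of alpha |-> pi_p(alpha, .), i.e. the row space of [pi p]. *)
Definition leaf_tangent pi p : 'M[R]_(3 * 3) := pi p.

Definition leaf_codim pi p : nat := (3 * 3 - \rank (leaf_tangent pi p))%N.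

(* Under mxvec, [kermx (jacobian f p)^T] is the space of tangent vectors at p
   that all the differentials of the f i annihilate. *)
Definition jacobian n (f : 'I_n -> lin_su2 R -> R) p : 'M[R]_(n, 3 * 3) :=
  \matrix_i differential (f i) p.

Definition complete_casimirs U pi n (f : 'I_n -> lin_su2 R -> R) : Prop :=
  (forall i, casimir U pi (f i)) /\
  forall p, U p ->
    [/\ row_free (jacobian f p),
        n = leaf_codim pi p
      & (kermx (jacobian f p)^T :=: leaf_tangent pi p)%MS].

End Poisson.

Section PiF.
Variables (R : realType) (ip : su2 R -> su2 R -> R).
Variable Psi : lin_su2 R -> 'I_3 -> su2 R.
Implicit Types (phi : lin_su2 R) (xi eta : su2 R).

Definition Phi phi : R := ip (Psi phi 0) (lie (Psi phi 1) (Psi phi 2)).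

Definition M_o : set (lin_su2 R) := [set phi | Phi phi != 0].

Definition A_contr xi eta phi : R :=
  let a := Psi phi 0 in let b := Psi phi 1 in let c := Psi phi 2 in
  (Phi phi)^-1 *
    (ip (lie a b) xi * ip (lie a b) eta + ip (lie b c) xi * ip (lie b c) eta
     + ip (lie c a) xi * ip (lie c a) eta).

Definition lcoord (i : 'I_3) xi phi : R := ip xi (Psi phi i).

Definition piF_relations (pi : lin_su2 R -> 'M[R]_(3 * 3)) : Prop :=
  forall xi eta phi, M_o phi ->
    let br i j := bracket pi (lcoord i xi) (lcoord j eta) phi in
    let l_lie i := lcoord i (lie xi eta) phi in
    [/\ br 0 0 = l_lie 0,
        br 0 1 = l_lie 1 /\ br 1 0 = l_lie 1,
        br 1 1 = - l_lie 0
      & [/\ br 0 2 = l_lie 2 /\ br 2 0 = l_lie 2,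
            br 2 2 = - l_lie 0,
            br 1 2 = A_contr xi eta phi
          & - br 2 1 = A_contr xi eta phi]].

Definition gram (i j : 'I_3) phi : R := ip (Psi phi i) (Psi phi j).

(* <a,b>, <b,c>, <c,a>, <a,a> - <b,b>, <b,b> - <c,c> *)
Definition casimir_functions (k : 'I_5) : lin_su2 R -> R :=
  nth (fun=> 0)
    [:: gram 0 1; gram 1 2; gram 2 0;
        (fun phi => gram 0 0 phi - gram 1 1 phi);
        (fun phi => gram 1 1 phi - gram 2 2 phi)] k.

End PiF.

(* Main.v *)
Require Import Defs.
From mathcomp Require Import all_boot all_order all_algebra.
From mathcomp Require Import complex ring.
From mathcomp Require Import all_classical all_reals all_analysis.

Set Implicit Arguments.
Unset Strict Implicit.
Unset Printing Implicit Defensive.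

Import Order.TTheory GRing.Theory Num.Theory.
Import numFieldNormedType.Exports.
Local Open Scope ring_scope.

(* At a point p = (a, b, c) of M_o the vectors v_0 = a, v_1 = b, v_2 = c are a
   basis of su(2), so the nine covectors d l^i_(v_j) form a basis of the
   cotangent space at p.  In this basis the matrix of pi is Phi(p) times a
   constant integer matrix.  Identifying the covector sum_ij X_ij d l^i_(v_j)
   with the 3 x 3 matrix X, contraction with pi only depends on the skew part
   and the trace of X: the rank is 4 and the kernel is the space of symmetric
   traceless X.  The differential of <v_i, v_j> is d l^i_(v_j) + d l^j_(v_i), so
   the differentials of the five functions form a basis of that kernel. *)

(** * Case analysis and sums over three and five indices *)

Lemma ord3P (P : 'I_3 -> Prop) : P 0 -> P 1 -> P 2 -> forall i, P i.
Proof.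
move=> P0 P1 P2 i.
have [-> | [-> | ->]] // : i = 0 \/ i = 1 \/ i = 2.
by case: i => [[|[|[|//]]] ?]; [left | right; left | right; right];
  apply/val_inj.
Qed.

Lemma sum_ord3 (V : zmodType) (F : 'I_3 -> V) : \sum_i F i = F 0 + F 1 + F 2.
Proof.
rewrite !big_ord_recl big_ord0 addr0 addrA.
by congr (_ + F _ + F _); apply/val_inj.
Qed.

Lemma sum_ord5 (V : zmodType) (F : 'I_5 -> V) :
  \sum_i F i = F 0 + F 1 + F 2 + F 3 + F 4.
Proof.
rewrite !big_ord_recl big_ord0 addr0 !addrA.
by do !congr (_ + _); congr (F _); apply/val_inj.
Qed.

Lemma ord5P (P : 'I_5 -> Prop) :
  P 0 -> P 1 -> P 2 -> P 3 -> P 4 -> forall i, P i.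
Proof.
move=> P0 P1 P2 P3 P4 i.
have [-> | [-> | [-> | [-> | ->]]]] // :
  i = 0 \/ i = 1 \/ i = 2 \/ i = 3 \/ i = 4.
case: i => [[|[|[|[|[|//]]]]] ?]; [left | right; left | right; right; left
  | right; right; right; left | do 4!right]; apply/val_inj => //.
Qed.

(** * The bracket and the Killing form of su(2) in coordinates *)

(** Since [i sigma_1, i sigma_2] = -2 i sigma_3 and cyclically, the bracket is -2 times the cross
    product. *)
Lemma lie_coord (R : realType) (x y : su2 R) :
  [/\ lie x y 0 0 = - 2 * (x 0 1 * y 0 2 - x 0 2 * y 0 1),
      lie x y 0 1 = - 2 * (x 0 2 * y 0 0 - x 0 0 * y 0 2)
    & lie x y 0 2 = - 2 * (x 0 0 * y 0 1 - x 0 1 * y 0 0)].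
Proof.
have E i j : (su2_mx x *m su2_mx y - su2_mx y *m su2_mx x) i j
   = su2_mx x i 0 * su2_mx y 0 j + su2_mx x i 1 * su2_mx y 1 j
     - (su2_mx y i 0 * su2_mx x 0 j + su2_mx y i 1 * su2_mx x 1 j).
  rewrite mxE [X in _ + X]mxE ![(_ *m _) i j]mxE !big_ord_recl !big_ord0 !addr0.
  by have -> : lift ord0 ord0 = 1 :> 'I_2 by apply/val_inj.
by split; rewrite mxE /= !E !mxE /=; simpc => /=; ring.
Qed.

(** The map z |-> x × (y × z) has trace -2 <x, y> for the dot product, and the two brackets
    contribute (-2)^2, whence -8. *)
Lemma killingE (R : realType) (x y : su2 R) :
  killing x y = - 8 * \sum_k x 0 k * y 0 k.
Proof.
have lie0 (u v : su2 R) := let: And3 e _ _ := lie_coord u v in e.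
have lie1 (u v : su2 R) := let: And3 _ e _ := lie_coord u v in e.
have lie2 (u v : su2 R) := let: And3 _ _ e := lie_coord u v in e.
rewrite /killing.
(* Unification would otherwise unfold [lie] and diverge. *)
move: (@lie R) lie0 lie1 lie2 => br br0 br1 br2.
rewrite /mxtrace !sum_ord3 ![(_ *m _) _ _]mxE !sum_ord3.
rewrite ![lin1_mx _ _ _]mxE !(br0, br1, br2).
have dE i j : (delta_mx 0 i : su2 R) 0 j = (j == i)%:R by rewrite mxE.
by rewrite !dE /=; ring.
Qed.

(** Positivity at one nonzero vector excludes a zero factor. *)
Lemma inner_killingE (R : realType) (ip : su2 R -> su2 R -> R) :
    inner_product ip -> (exists k : R, forall x y, ip x y = k * killing x y) ->
  exists2 c : R, c != 0 & forall x y, ip x y = c * \sum_k x 0 k * y 0 k.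
Proof.
move=> [_ _ ip_pos] [k ipE]; exists (k * - 8); last first.
  by move=> x y; rewrite ipE killingE mulrA.
apply/eqP => k0; have /ip_pos : const_mx 1 != 0 :> su2 R.
  by apply/eqP => /rowP/(_ 0)/eqP; rewrite !mxE oner_eq0.
by rewrite ipE killingE mulrA k0 mul0r ltxx.
Qed.

(** * Derivatives and smoothness of polynomial functions *)

(* Unlike [smooth_on], membership in this class only needs first derivatives:
   it is stable under ['D_v] by the Leibniz rule. *)
Inductive polynomial_fun (R : realType) : ('M[R]_3 -> R) -> Prop :=
| PolyConst c : polynomial_fun (fun=> c)
| PolyCoord i j : polynomial_fun (fun p => p i j)
| PolyAdd f g : polynomial_fun f -> polynomial_fun g ->
    polynomial_fun (fun p => f p + g p)
| PolyMul f g : polynomial_fun f -> polynomial_fun g ->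
    polynomial_fun (fun p => f p * g p).

(** The difference quotient of a linear function does not depend on the increment, so its limit is
    immediate. *)
Lemma derive_linear (R : realType) (f : 'M[R]_3 -> R) (v p : 'M[R]_3) :
  (forall h u w, f (h *: u + w) = h * f u + f w) -> 'D_v f p = f v.
Proof.
move=> f_lin; apply: cvg_lim => //; apply: cvg_near_cst.
near=> h; rewrite /= f_lin addrK.
have h0 : h != 0 by near: h; exact: nbhs_dnbhs_neq.
exact: mulKf.
Unshelve. all: by end_near.
Qed.

Lemma polynomial_fun_differentiable (R : realType) (f : 'M[R]_3 -> R) p :
  polynomial_fun f -> differentiable f p.
Proof.
elim=> {f} [c | i j | f g _ df _ dg | f g _ df _ dg].
- exact: differentiable_cst.
- exact: differentiable_coord.
- exact: differentiableD.
- exact: differentiableM.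
Qed.

Lemma derivable_polynomial_fun (R : realType) (f : 'M[R]_3 -> R) p v :
  polynomial_fun f -> derivable f p v.
Proof. by move=> pf; apply/diff_derivable/polynomial_fun_differentiable. Qed.

Lemma polynomial_fun_derive (R : realType) (f : 'M[R]_3 -> R) v :
  polynomial_fun f -> polynomial_fun (fun p => 'D_v f p).
Proof.
elim=> {f} [c | i j | f g pf IHf pg IHg | f g pf IHf pg IHg].
- have -> : (fun p => 'D_v (fun=> c) p) = fun=> 0.
    by apply/funext => p; apply: derive_cst.
  exact: PolyConst.
- have -> : (fun p => 'D_v (fun q : 'M[R]_3 => q i j : R) p) = fun=> v i j.
    by apply/funext => p; apply: derive_linear => h u w; rewrite !mxE.
  exact: PolyConst.
- have -> : (fun p => 'D_v (fun q => f q + g q) p)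
      = fun p => 'D_v f p + 'D_v g p.
    by apply/funext => p; apply: deriveD; apply: derivable_polynomial_fun.
  exact: PolyAdd.
- have -> : (fun p => 'D_v (fun q => f q * g q) p)
      = fun p => f p * 'D_v g p + g p * 'D_v f p.
    by apply/funext => p; apply: deriveM; apply: derivable_polynomial_fun.
  by apply: PolyAdd; exact: PolyMul.
Qed.

Lemma polynomial_fun_smooth (R : realType) U (f : 'M[R]_3 -> R) :
  polynomial_fun f -> smooth_on U f.
Proof.
move=> pf vs p _; apply: polynomial_fun_differentiable.
by elim: vs => //= v vs; apply: polynomial_fun_derive.
Qed.

Lemma polynomial_fun_sum (R : realType) n (F : 'I_n -> 'M[R]_3 -> R) :
  (forall k, polynomial_fun (F k)) -> polynomial_fun (fun p => \sum_k F k p).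
Proof.
elim: n F => [|n IH] F pF.
  have -> : (fun p => \sum_k F k p) = fun=> 0.
    by apply/funext => p; rewrite big_ord0.
  exact: PolyConst.
have -> : (fun p => \sum_k F k p)
    = fun p => F ord0 p + \sum_k (fun k => F (lift ord0 k)) k p.
  by apply/funext => p; rewrite big_ord_recl.
by apply: PolyAdd => //; apply: IH.
Qed.

(** * The frame identification as an invertible matrix *)

(** Pairing the defining relation of [Psi] at x with [e i] gives <Psi phi i, x> = <x phi, e_i>.
    Taking basis vectors for x yields the formula, with W_mi equal to <delta_m, e_i> divided by
    [c]. *)
Lemma frame_coordinatesE (R : realType) (c : R) (ip ipV : su2 R -> su2 R -> R)
    (s : bool) (e : 'I_3 -> su2 R) (Psi : lin_su2 R -> 'I_3 -> su2 R) :
    c != 0 -> (forall x y, ip x y = c * \sum_k x 0 k * y 0 k) ->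
    inner_product ipV -> frame ipV s e -> frame_coordinates ip e Psi ->
  exists2 W : 'M[R]_3, W \in unitmx
    & forall phi i k, Psi phi i 0 k = \sum_m phi k m * W m i.
Proof.
move=> c0 ipE [_ ipV_lin _] [ipV_e _] PsiE.
have ipVD x y z : ipV (x + y) z = ipV x z + ipV y z.
  by rewrite -{1}[x]scale1r ipV_lin mul1r.
have ipV0 z : ipV 0 z = 0.
  by apply: (addrI (ipV 0 z)); rewrite -ipVD !addr0.
have ipVZ k x z : ipV (k *: x) z = k * ipV x z.
  by rewrite -[k *: x]addr0 ipV_lin ipV0 addr0.
have ipV_sum (F : 'I_3 -> su2 R) z : ipV (\sum_i F i) z = \sum_i ipV (F i) z.
  by rewrite !sum_ord3 !ipVD.
have ipV_row x i : ipV x (e i) = \sum_m x 0 m * ipV (delta_mx 0 m) (e i).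
  by rewrite {1}(row_sum_delta x) ipV_sum; apply: eq_bigr => m _; rewrite ipVZ.
pose W := \matrix_(m, i) ipV (delta_mx 0 m) (e i) : 'M[R]_3.
exists (c^-1 *: W).
  rewrite unitmxZ ?unitfE ?invr_eq0 //.
  (* This product is the Gram matrix of the orthonormal frame. *)
  suff /mulmx1_unit[] : (\matrix_i e i) *m W = 1%:M by [].
  apply/matrixP => i j; rewrite !mxE -ipV_e ipV_row.
  by apply: eq_bigr => m _; rewrite !mxE.
move=> phi i k; apply: (mulfI c0).
have -> : c * Psi phi i 0 k = ip (Psi phi i) (delta_mx 0 k).
  rewrite ipE; congr (_ * _); rewrite (bigD1 k) //= mxE !eqxx mulr1 big1 ?addr0 //.
  by move=> m /negPf mk; rewrite mxE mk andbF mulr0.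
have -> : ip (Psi phi i) (delta_mx 0 k) = ipV (delta_mx 0 k *m phi) (e i).
  rewrite PsiE ipV_sum (bigD1 i) //= ipVZ ipV_e eqxx mulr1 big1 ?addr0 //.
  by move=> m /negPf mi; rewrite ipVZ ipV_e mi mulr0.
rewrite -rowE ipV_row mulr_sumr; apply: eq_bigr => m _.
by rewrite !mxE mulrCA mulVKf.
Qed.

Lemma polynomial_funB (R : realType) (f g : 'M[R]_3 -> R) :
  polynomial_fun f -> polynomial_fun g ->
  polynomial_fun (fun p => f p - g p).
Proof.
move=> pf pg; have -> : (fun p => f p - g p) = fun p => f p + (-1) * g p.
  by apply/funext => p; rewrite mulN1r.
by apply: PolyAdd => //; apply: PolyMul => //; apply: PolyConst.
Qed.

(** * Brackets of the coordinate functions on the basis a, b, c *)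

(* The Levi-Civita symbol, with addition of indices modulo 3. *)
Definition eps (i j k : 'I_3) : int :=
  ((j == i + 1) && (k == i + 2))%:Z - ((j == i + 2) && (k == i + 1))%:Z.

(** By [lie_coord] the left side is -2c times the determinant of v_i, v_j, v_k, hence alternating in
    the indices. *)
Lemma triple_product (R : realType) (c : R) (ip : su2 R -> su2 R -> R)
    (v : 'I_3 -> su2 R) i j k :
    (forall x y, ip x y = c * \sum_k x 0 k * y 0 k) ->
  ip (v i) (lie (v j) (v k)) = ip (v 0) (lie (v 1) (v 2)) * (eps i j k)%:~R.
Proof.
move=> ipE.
move: (lie _ _) (lie_coord (v j) (v k)) => u [u0 u1 u2].
move: (lie _ _) (lie_coord (v 1) (v 2)) => w [w0 w1 w2].
rewrite !ipE !sum_ord3 {}u0 {}u1 {}u2 {}w0 {}w1 {}w2.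
have eE (b1 b2 b3 b4 : bool) : ((b1 && b2)%:Z - (b3 && b4)%:Z)%:~R
  = (b1 && b2)%:R - (b3 && b4)%:R :> R by rewrite intrD rmorphN.
rewrite /eps eE.
by elim/ord3P: i; elim/ord3P: j; elim/ord3P: k => /=; ring.
Qed.

(* The value of {l^i_(v_j), l^k_(v_l)} / Phi at (v_0, v_1, v_2) = (a, b, c). *)
Definition table (i j k l : 'I_3) : int :=
  if i == 0 then eps k j l else if k == 0 then eps i j l
  else if i == k then - eps 0 j l
  else if i == 1 then (j == l)%:Z else - (j == l)%:Z.

Lemma bracket_table (R : realType) (c : R) (ip : su2 R -> su2 R -> R)
    (Psi : lin_su2 R -> 'I_3 -> su2 R) pi p i j k l :
    (forall x y, ip x y = c * \sum_k x 0 k * y 0 k) ->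
    piF_relations ip Psi pi -> M_o ip Psi p ->
  bracket pi (lcoord ip Psi i (Psi p j)) (lcoord ip Psi k (Psi p l)) p
    = Phi ip Psi p * (table i j k l)%:~R.
Proof.
move=> ipE rel Mp.
have ipC x y : ip x y = ip y x.
  by rewrite !ipE; congr (_ * _); apply: eq_bigr => m _; rewrite mulrC.
have lE m : lcoord ip Psi m (lie (Psi p j) (Psi p l)) p
    = Phi ip Psi p * (eps m j l)%:~R.
  by rewrite /lcoord ipC (triple_product _ _ _ _ ipE).
(* Each of [a,b], [b,c], [c,a] is orthogonal to its two factors and pairs to Phi with the remaining
   vector. So one square Phi^2 survives when j = l, and nothing otherwise. *)
have AE : A_contr ip Psi (Psi p j) (Psi p l) p = Phi ip Psi p * (j == l)%:R.
  have tE m n r : ip (lie (Psi p n) (Psi p r)) (Psi p m)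
      = Phi ip Psi p * (eps m n r)%:~R by rewrite ipC (triple_product _ _ _ _ ipE).
  rewrite /A_contr.
  move: (lie (Psi p 0) _) (fun m => tE m 0 1) => u tu.
  move: (lie (Psi p 1) _) (fun m => tE m 1 2) => w tw.
  move: (lie (Psi p 2) _) (fun m => tE m 2 0) => z tz.
  rewrite !{}tu !{}tw !{}tz; apply: (mulfI Mp); rewrite mulVKf //.
  by elim/ord3P: (j); elim/ord3P: (l); rewrite /eps /=; ring.
have [r00 [r01 r10] r11 [[r02 r20] r22 r12 r21]] := rel (Psi p j) (Psi p l) p Mp.
rewrite /table; elim/ord3P: i; elim/ord3P: k => /=.
- by rewrite r00.
- by rewrite r01.
- by rewrite r02.
- by rewrite r10.
- by rewrite r11 lE rmorphN mulrN.
- by rewrite r12.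
- by rewrite r20.
- by rewrite -[LHS]opprK r21 AE rmorphN mulrN.
- by rewrite r22 lE rmorphN mulrN.
Qed.

(** * Linear algebra in the cotangent space at one point *)

(** As a 3 x 3 matrix, the combination with coefficients X is c Q X^T W^T, and this map of X is
    invertible. *)
Lemma rV9_basis (R : realType) (ell : 'I_3 -> 'I_3 -> 'rV[R]_(3 * 3))
    (c : R) (Q W : 'M[R]_3) :
    c != 0 -> Q \in unitmx -> W \in unitmx ->
    (forall i j, ell i j = mxvec (\matrix_(k, m) (c * Q k j * W m i))) ->
  (forall X : 'M[R]_3, \sum_i \sum_j X i j *: ell i j = 0 -> X = 0) /\
  (forall w, exists X : 'M[R]_3, w = \sum_i \sum_j X i j *: ell i j).
Proof.
move=> c0 Qu Wu ellE.
have sumE (X : 'M[R]_3) : \sum_i \sum_j X i j *: ell i j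
    = mxvec (c *: (Q *m X^T *m W^T)).
  rewrite -[LHS]vec_mxK; congr mxvec; apply/matrixP => k m.
  rewrite !sum_ord3 !ellE !linearD !linearZ /= !mxvecK !mxE.
  rewrite sum_ord3 !mxE !sum_ord3 !mxE; ring.
split=> [X | w].
  rewrite sumE => /(congr1 vec_mx); rewrite mxvecK linear0 => /eqP.
  rewrite scaler_eq0 (negPf c0) /= => /eqP /(congr1 (mulmxr (invmx W^T))).
  rewrite /= mulmxK ?unitmx_tr // mul0mx => /(congr1 (mulmx (invmx Q))).
  by rewrite mulKmx // mulmx0 => /(canRL (@trmxK _ _ _)) ->; rewrite trmx0.
exists (c^-1 *: (invmx Q *m vec_mx w *m invmx W^T))^T.
rewrite sumE trmxK -scalemxAr -scalemxAl scalerA divff // scale1r.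
by rewrite mulmxA mulKVmx // mulmxKV ?unitmx_tr // vec_mxK.
Qed.

(** This makes the differentials of <a,b>, <b,c>, <c,a> annihilate the bivector. *)
Lemma table_skew i j k l : i != j -> table i j k l = - table j i k l.
Proof. by elim/ord3P: i; elim/ord3P: j; elim/ord3P: k; elim/ord3P: l. Qed.

(** This does the same for the differences of squared norms. *)
Lemma table_diag i j k l : table i i k l = table j j k l.
Proof. by elim/ord3P: i; elim/ord3P: j; elim/ord3P: k; elim/ord3P: l. Qed.

Section Conormal.
Variables (R : realType) (pi : 'M[R]_(3 * 3)) (phi : R).
Variable ell : 'I_3 -> 'I_3 -> 'rV[R]_(3 * 3).
Hypothesis phi0 : phi != 0.
Hypothesis ell_free :
  forall X : 'M[R]_3, \sum_i \sum_j X i j *: ell i j = 0 -> X = 0.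
Hypothesis ell_span :
  forall w, exists X : 'M[R]_3, w = \sum_i \sum_j X i j *: ell i j.
Hypothesis ell_table : forall i j k l,
  (ell i j *m pi *m (ell k l)^T) 0 0 = phi * (table i j k l)%:~R.

(** With [phi] for Phi(p) and [ell i j] for d l^i_(v_j) at p, [sym i j] is the differential of <v_i,
    v_j>, and [rows] lists the differentials of the five functions in order. *)
Let sym i j := ell i j + ell j i.
Let rows := [:: sym 0 1; sym 1 2; sym 2 0; sym 0 0 - sym 1 1;
                sym 1 1 - sym 2 2].

Lemma row_free_conormal : row_free (\matrix_(k < 5) rows`_k).
Proof.
apply: inj_row_free => v v0.
(* A combination of the rows is the form of a symmetric traceless matrix. *)
pose X : 'M[R]_3 := \matrix_(i, j)
  (nth [::] [:: [:: 2 * v 0 3; v 0 0; v 0 2];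
                [:: v 0 0; 2 * (v 0 4 - v 0 3); v 0 1];
                [:: v 0 2; v 0 1; - 2 * v 0 4]] i)`_j.
have /ell_free/matrixP X0 : \sum_i \sum_j X i j *: ell i j = 0.
  rewrite -[RHS]v0; apply/rowP => m; rewrite !mxE sum_ord5 !sum_ord3 !mxE /=; ring.
apply/rowP => k; rewrite mxE.
have h (x : R) : 2 * x = 0 -> x = 0.
  by move=> /eqP; rewrite mulf_eq0 pnatr_eq0 /= => /eqP.
move: (X0 0 0) (X0 0 1) (X0 1 2) (X0 2 0) (X0 2 2); rewrite !mxE /=.
rewrite mulNr => /h v3 v0' v1 v2 /eqP; rewrite oppr_eq0 => /eqP /h v4.
by elim/ord5P: k.
Qed.

Lemma conormal_annihilates : (\matrix_(k < 5) rows`_k) *m pi = 0.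
Proof.
(* Because the [ell k l] span, a vector pairing to zero with all of them has zero coordinates. *)
have ell_eq0 (u : 'rV_(3 * 3)) :
    (forall k l, (u *m pi *m (ell k l)^T) 0 0 = 0) -> u *m pi = 0.
  move=> u0; apply/rowP => m; rewrite [RHS]mxE.
  have [X XE] := ell_span (delta_mx 0 m).
  have -> : (u *m pi) 0 m = (u *m pi *m (delta_mx 0 m : 'rV_(3 * 3))^T) 0 0.
    by rewrite trmx_delta -colE [RHS]mxE.
  have u0' k l : u *m pi *m (ell k l)^T = 0.
    by apply/rowP => n; rewrite ord1 u0 mxE.
  by rewrite XE !sum_ord3 !linearD !linearZ /= !u0' !scaler0 !addr0 mxE.
have tableE i j k l :
    ell i j *m pi *m (ell k l)^T = (phi * (table i j k l)%:~R)%:M.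
  by apply/rowP => n; rewrite ord1 ell_table mxE eqxx.
have sym0 i j : i != j -> sym i j *m pi = 0.
  move=> ij; apply: ell_eq0 => k l.
  rewrite !mulmxDl !tableE (table_skew _ _ ij) rmorphN mulrN.
  by rewrite raddfN addNr mxE.
have diag0 i j : (sym i i - sym j j) *m pi = 0.
  apply: ell_eq0 => k l.
  by rewrite !mulmxBl !mulmxDl !tableE (table_diag i j) subrr mxE.
apply/row_matrixP => k; rewrite row_mul rowK row0.
by elim/ord5P: k => /=; rewrite ?sym0 ?diag0.
Qed.

(** Five independent covectors in the kernel bound the rank by 9 - 5. Conversely, on the span of
    four suitable covectors the form is [phi] times a standard symplectic form, hence
    nondegenerate. *)
Lemma rank_conormal : \rank pi = 4%N.
Proof.
apply/eqP; rewrite eqn_leq; apply/andP; split.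
  have := mulmx0_rank_max conormal_annihilates.
  by rewrite (eqP row_free_conormal) -(leq_add2l 5).
(* [L] and [N] select a diagonal 4 x 4 minor of the table. *)
pose L := \matrix_(s < 4) [:: ell 0 1; ell 0 2; ell 1 2; ell 0 0]`_s.
pose N := \matrix_(s < 4) [:: ell 0 2; ell 0 1; ell 0 0; ell 1 2]`_s.
have LN : L *m pi *m N^T = diag_mx (\row_s (phi * (-1) ^+ s)).
  apply/matrixP => s t.
  have -> : (L *m pi *m N^T) s t = (row s L *m pi *m (row t N)^T) 0 0.
    rewrite tr_row -row_mul [LHS]mxE [RHS]mxE; apply: eq_bigr => m _.
    by congr (_ * _); rewrite [RHS]mxE.
  rewrite !rowK [RHS]mxE [in RHS]mxE; case: s => [[|[|[|[|//]]]] ?];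
    case: t => [[|[|[|[|//]]]] ?];
    rewrite /= ell_table /table /eps /=; ring.
have /mxrank_unit rk : L *m pi *m N^T \in unitmx.
  rewrite LN unitmxE det_diag unitfE; apply/prodf_neq0 => s _.
  by rewrite mxE mulf_neq0 // expf_neq0 // oppr_eq0 oner_eq0.
have : (\rank (L *m pi *m N^T) <= \rank pi)%N.
  exact: leq_trans (mxrankM_maxl _ _) (mxrankM_maxr _ _).
by rewrite rk.
Qed.
End Conormal.

(** * Differentials of the coordinate functions and of the inner products *)

Section Coordinates.
Variables (R : realType) (c : R) (ip : su2 R -> su2 R -> R) (W : 'M[R]_3).
Variable Psi : lin_su2 R -> 'I_3 -> su2 R.
Hypothesis ipE : forall x y, ip x y = c * \sum_k x 0 k * y 0 k.
Hypothesis PsiE : forall phi i k, Psi phi i 0 k = \sum_m phi k m * W m i.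

Lemma lcoord_linear i xi h (u w : lin_su2 R) :
  lcoord ip Psi i xi (h *: u + w)
    = h * lcoord ip Psi i xi u + lcoord ip Psi i xi w.
Proof.
rewrite /lcoord !ipE mulrCA -mulrDr; congr (_ * _).
rewrite mulr_sumr -big_split /=; apply: eq_bigr => k _.
rewrite !PsiE !mulr_sumr -big_split /=.
by apply: eq_bigr => m _; rewrite !mxE; ring.
Qed.

Lemma differential_lcoord i xi p :
  differential (lcoord ip Psi i xi) p
    = mxvec (\matrix_(k, m) (c * xi 0 k * W m i)).
Proof.
congr mxvec; apply/matrixP => k m; rewrite !mxE derive_linear; last first.
  by move=> h u w; apply: lcoord_linear.
rewrite /lcoord ipE -mulrA; congr (_ * _).
rewrite (bigD1 k) //= big1 => [|n /negPf nk].
  rewrite addr0 PsiE (bigD1 m) //= mxE !eqxx mul1r big1 ?addr0 //.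
  by move=> n /negPf nm; rewrite mxE nm andbF mul0r.
by rewrite PsiE big1 ?mulr0 // => r _; rewrite mxE nk mul0r.
Qed.

Lemma polynomial_fun_Psi i k : polynomial_fun (fun p => Psi p i 0 k).
Proof.
have -> : (fun p => Psi p i 0 k)
    = fun p => \sum_m (fun m (q : 'M[R]_3) => q k m * W m i) m p.
  by apply/funext => p; rewrite PsiE.
apply: polynomial_fun_sum => m.
by apply: PolyMul; [exact: PolyCoord | exact: PolyConst].
Qed.

(** The factor [c] is moved into the sum so that each summand is a product of two polynomial
    functions; the explicit function of k fits [polynomial_fun_sum]. *)
Lemma gramE i j : gram ip Psi i j
  = fun p => \sum_k (fun k q => (c * Psi q i 0 k) * Psi q j 0 k) k p.
Proof.
apply/funext => p; rewrite /gram ipE mulr_sumr.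
by apply: eq_bigr => k _; rewrite mulrA.
Qed.

Lemma polynomial_fun_gram i j : polynomial_fun (gram ip Psi i j).
Proof.
rewrite gramE; apply: polynomial_fun_sum => k.
apply: PolyMul; last exact: polynomial_fun_Psi.
by apply: PolyMul; [exact: PolyConst | exact: polynomial_fun_Psi].
Qed.

(** This is the Leibniz rule for a bilinear form composed with the linear maps [Psi]. *)
Lemma derive_gram i j v p : 'D_v (gram ip Psi i j) p
  = lcoord ip Psi i (Psi p j) v + lcoord ip Psi j (Psi p i) v.
Proof.
have PsiD n k : 'D_v (fun q => Psi q n 0 k : R) p = Psi v n 0 k.
  apply: derive_linear => h u w; rewrite !PsiE mulr_sumr -big_split /=.
  by apply: eq_bigr => m _; rewrite !mxE; ring.
have pPsi n k := polynomial_fun_Psi n k.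
have pF k : polynomial_fun (fun q => c * Psi q i 0 k).
  by apply: PolyMul; [exact: PolyConst |].
have -> : gram ip Psi i j
    = \sum_k (fun q => c * Psi q i 0 k) * (fun q => Psi q j 0 k).
  by apply/funext => q; rewrite gramE fct_sumE.
rewrite derive_sum => [|k]; last first.
  by apply/derivable_polynomial_fun/PolyMul.
rewrite /lcoord !ipE !mulr_sumr -big_split /=; apply: eq_bigr => k _.
rewrite deriveM; try exact: derivable_polynomial_fun.
have -> : (fun q => c * Psi q i 0 k) = c \*: (fun q => Psi q i 0 k) by [].
rewrite deriveZ; last exact: derivable_polynomial_fun.
by rewrite !PsiD /= /GRing.scale /=; ring.
Qed.

Lemma differential_gram i j p : differential (gram ip Psi i j) p
  = differential (lcoord ip Psi i (Psi p j)) p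
    + differential (lcoord ip Psi j (Psi p i)) p.
Proof.
rewrite /differential -linearD; congr mxvec; apply/matrixP => k m.
rewrite !mxE derive_gram.
by congr (_ + _); apply/esym/derive_linear => h u w; apply: lcoord_linear.
Qed.

Lemma differential_gramB i j p :
  differential (fun q => gram ip Psi i i q - gram ip Psi j j q) p
    = differential (gram ip Psi i i) p - differential (gram ip Psi j j) p.
Proof.
rewrite /differential -linearB; congr mxvec; apply/matrixP => k m.
rewrite !mxE; apply: deriveB;
  exact/derivable_polynomial_fun/polynomial_fun_gram.
Qed.

Lemma M_o_unitmx p : M_o ip Psi p ->
  \matrix_(k, j) Psi p j 0 k \in unitmx.
Proof.
move=> Mp.
(* The rows are the brackets [b,c], [c,a], [a,b], scaled by [c]: up to the factor Phi, the basis
   dual to a, b, c. *)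
pose K : 'M[R]_3 := \matrix_(i, k) (c * lie (Psi p (i + 1)) (Psi p (i + 2)) 0 k).
suff KQ : K *m \matrix_(k, j) Psi p j 0 k = (Phi ip Psi p)%:M.
  have : (Phi ip Psi p)^-1 *: K *m \matrix_(k, j) Psi p j 0 k = 1%:M.
    by rewrite -scalemxAl KQ scale_scalar_mx mulVf.
  by case/mulmx1_unit.
apply/matrixP => i j; rewrite !mxE.
(* The Kronecker delta is written as a Levi-Civita symbol so that [triple_product] applies. *)
have -> : (Phi ip Psi p) *+ (i == j)
    = Phi ip Psi p * (eps j (i + 1) (i + 2))%:~R.
  by elim/ord3P: i; elim/ord3P: j; rewrite /eps /= ?mulr1n ?mulr0n; ring.
rewrite -(triple_product _ _ _ _ ipE) ipE mulr_sumr.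
by apply: eq_bigr => k _; rewrite !mxE mulrA mulrAC -mulrA.
Qed.

End Coordinates.

Theorem proposition4p5 (R : realType)
    (ip : su2 R -> su2 R -> R) (ip_inner : inner_product ip)
    (ip_killing : exists k : R, forall x y, ip x y = k * killing x y)
    (ipV : su2 R -> su2 R -> R) (ipV_inner : inner_product ipV) (s : bool)
    (e : 'I_3 -> su2 R) (e_frame : frame ipV s e)
    (Psi : lin_su2 R -> 'I_3 -> su2 R)
    (Psi_coord : frame_coordinates ip e Psi)
    (pi : lin_su2 R -> 'M[R]_(3 * 3))
    (pi_poisson : poisson_structure (M_o ip Psi) pi)
    (pi_rel : piF_relations ip Psi pi) :
  complete_casimirs (M_o ip Psi) pi (casimir_functions ip Psi).
Proof.
have [c c0 ipE] := inner_killingE ip_inner ip_killing.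
have [W Wu PsiE] := frame_coordinatesE c0 ipE ipV_inner e_frame Psi_coord.
pose ell p i j := differential (lcoord ip Psi i (Psi p j)) p.
pose sym p i j := ell p i j + ell p j i.
pose rows p := [:: sym p 0 1; sym p 1 2; sym p 2 0; sym p 0 0 - sym p 1 1;
                   sym p 1 1 - sym p 2 2].
have jacE p : Defs.jacobian (casimir_functions ip Psi) p
    = \matrix_(k < 5) (rows p)`_k.
  apply/row_matrixP => k; rewrite !rowK.
  by elim/ord5P: k; rewrite /casimir_functions /= ?(differential_gramB ipE PsiE)
    !(differential_gram ipE PsiE).
have ell_table p i j k l : M_o ip Psi p ->
    (ell p i j *m pi p *m (ell p k l)^T) 0 0
      = Phi ip Psi p * (table i j k l)%:~R.
  by move=> Mp; apply: bracket_table ipE pi_rel Mp.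
have ellE p i j : ell p i j = mxvec (\matrix_(k, m)
    (c * (\matrix_(k, j) Psi p j 0 k : 'M[R]_3) k j * W m i)).
  rewrite /ell (differential_lcoord ipE PsiE); congr mxvec.
  by apply/matrixP => k m; rewrite !mxE.
have [pi_skew _ _] := pi_poisson.
have jac_facts p : M_o ip Psi p ->
    [/\ row_free (Defs.jacobian (casimir_functions ip Psi) p),
        Defs.jacobian (casimir_functions ip Psi) p *m pi p = 0
      & \rank (pi p) = 4%N].
  move=> Mp; have [ell_free ell_span] :=
    rV9_basis c0 (M_o_unitmx ipE Mp) Wu (ellE p).
  have tab i j k l := ell_table p i j k l Mp.
  rewrite jacE; split; first exact: row_free_conormal.
    exact: conormal_annihilates ell_span tab.
  exact: rank_conormal Mp ell_free ell_span tab.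
split=> [k | p Mp].
  split.
    apply: polynomial_fun_smooth.
    have pg i j := polynomial_fun_gram ipE PsiE i j.
    by elim/ord5P: k; rewrite /casimir_functions /= //; apply: polynomial_funB.
  (* The bracket with [h] factors through row k of the jacobian times [pi p], which vanishes. *)
  move=> h _ p Mp; have [_ /row_matrixP/(_ k) J0 _] := jac_facts p Mp.
  by move: J0; rewrite row_mul rowK row0 /bracket => ->; rewrite mul0mx mxE.
have [Jfree J0 rk] := jac_facts p Mp.
split=> //; first by rewrite /leaf_codim /leaf_tangent rk.
(* Skew-symmetry turns J pi = 0 into pi J^T = 0, which puts the leaf tangent space inside the common
   kernel. *)
have sub : (pi p <= kermx (Defs.jacobian (casimir_functions ip Psi) p)^T)%MS.
  apply/sub_kermxP/trmx_inj.
  by rewrite trmx_mul trmxK pi_skew // mulmxN J0 oppr0 trmx0.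
(* The inclusion is an equality since both ranks are 4 = 9 - 5. *)
apply/eqmx_sym/eqmxP; rewrite -(mxrank_leqif_eq sub).
by rewrite rk mxrank_ker mxrank_tr (eqP Jfree).
Qed.
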